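(* Let $d\ge 1$, $T\in\mathbb{R}$, $\lambda\in\mathbb{R}^d$ with positive entries, $\alpha\in(\frac13,\frac12]$ and $\rho\in\mathbb{R}^d$ with $0<\rho^i<\lambda^i$ for all $i=1,\dots,d$. Let $\mathbf{X}=(\mathbb{X}^1,\mathbb{X}^2)\in\mathscr{C}^{\alpha,\rho}((-\infty,T],\mathbb{R}^d)$ be an exponentially weighted rough path. Then the EFM-signature $\mathbb{X}^{\lambda}=(\mathbb{X}^{\lambda,n}_{s,t})_{n\ge 0,\,-\infty\le s\le t\le T}$ of $\mathbf X$ is well-defined (i.e. all the limits in its recursive definition by rough convolution exist). Moreover, for all $s\in[-\infty,T]$ and all $n\ge 0$, the function $t\mapsto\mathbb{X}^{\lambda,n}_{s,t}$ satisfies $$\mathbb{X}^{\lambda,n}_{s,\cdot}\in\hat{\mathcal{C}}^{\alpha,\rho}_b((s,T]).$$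
   Context: Tensors. Words $v=i_1\cdots i_n$ over $\{1,\dots,d\}$ index the basis vectors $e_{i_1}\otimes\cdots\otimes e_{i_n}$ of $(\mathbb{R}^d)^{\otimes n}$, and $(\mathbb{R}^d)^{\otimes 0}=\mathbb{R}$. For $\mu\in\mathbb{R}^d$ and a word $v=i_1\cdots i_n$ put $\mu^{v}=\sum_{k=1}^n\mu^{i_k}$ (and $0$ for the empty word). For $h\in\mathbb{R}$ the operator $\mathbf{D}^{\mu}_h$ acts on $(\mathbb{R}^d)^{\otimes n}$ diagonally: it multiplies the coefficient of the word $v$ by $e^{-\mu^{v}h}$. Write $\mathbf{D}_h=\mathbf{D}^{\lambda}_h$. $|\cdot|$ is the Euclidean norm on $(\mathbb{R}^d)^{\otimes n}$. Weighted norms. For two-parameter functions $A=(A_{u,v})_{u\le v\le T}$ and one-parameter functions $f$ with values in some $(\mathbb{R}^d)^{\otimes n}$, put $$\|A\|_{\alpha,\rho}=\sup_{u<v\le T,\ v-u<1}\frac{|\mathbf{D}^{\rho}_{T-u}A_{u,v}|}{|v-u|^{\alpha}},\qquad \hat\delta f_{u,v}=f_v-\mathbf{D}_{v-u}f_u,\qquad \|f\|^{\wedge}_{\alpha,\rho}=\|\hat\delta f\|_{\alpha,\rho},\qquad \|f\|_{\infty,\rho}=\sup_{t\le T}|\mathbf{D}^{\rho}_{T-t}f_t|.$$ $\hat{\mathcal{C}}^{\alpha,\rho}_b((s,T])$ is the space of functions on $(s,T]$ for which $\|f\|^\wedge_{\alpha,\rho}+\|f\|_{\infty,\rho}<\infty$,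 where the suprema are restricted to times in $(s,T]$ (for $s=-\infty$ all times $\le T$). Rough paths. $\mathscr{C}^{\alpha,\rho}((-\infty,T],\mathbb{R}^d)$ is the set of pairs $\mathbf{X}=(\mathbb{X}^1,\mathbb{X}^2)$, where $\mathbb{X}^1_{s,t}=X_t-X_s\in\mathbb{R}^d$ is the increment of a path $X$ and $\mathbb{X}^2_{s,t}\in(\mathbb{R}^d)^{\otimes 2}$, with $\|\mathbb{X}^1\|_{\alpha,\rho}<\infty$, $\|\mathbb{X}^2\|_{2\alpha,\rho}<\infty$ and Chen's identity $\mathbb{X}^2_{s,t}=\mathbb{X}^2_{s,u}+\mathbb{X}^2_{u,t}+\mathbb{X}^1_{s,u}\otimes\mathbb{X}^1_{u,t}$ for all $s\le u\le t\le T$. EFM-signature (exponentially fading memory signature) of $\mathbf X$. For paths $(Y,Y')$, with $Y$ valued in $(\mathbb{R}^d)^{\otimes n}$ and $Y'$ in $(\mathbb{R}^d)^{\otimes(n-1)}$ (with $Y'=0$ if $n=0$), and finite $r<t$, the rough convolution is $$\int_r^t\mathbf{D}_{t-u}(Y_u\,d\mathbf{X}_u)=\lim_{|\mathcal{P}|\to0}\sum_{[u,v]\in\mathcal{P}}\mathbf{D}_{t-u}\big(Y_u\otimes\mathbb{X}^1_{u,v}+Y'_u\otimes\mathbb{X}^2_{u,v}\big),$$ the limit being over partitions $\mathcal P$ of $[r,t]$ with mesh tending to $0$, and $\int_{-\infty}^t:=\lim_{R\to-\infty}\int_R^t$. The EFM-signature is defined recursively by $\mathbb{X}^{\lambda,0}_{s,t}=1$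 and $$\mathbb{X}^{\lambda,n+1}_{s,t}=\int_s^t\mathbf{D}_{t-u}(\mathbb{X}^{\lambda,n}_{s,u}\,d\mathbf{X}_u),\qquad -\infty\le s\le t\le T,$$ taking $Y_u=\mathbb{X}^{\lambda,n}_{s,u}$ and $Y'_u=\mathbb{X}^{\lambda,n-1}_{s,u}$ (with $\mathbb{X}^{\lambda,-1}:=0$). It is the rough-path meaning of the iterated integrals $\int_{s<u_1<\dots<u_n<t}\bigotimes_{k=1}^n \mathbf{D}_{t-u_k}(dX_{u_k})$. *)

(* Defs.v *)
From HB Require Import structures.
From mathcomp Require Import all_boot all_order all_algebra.
From mathcomp Require Import all_classical all_reals all_analysis.
Import Order.TTheory GRing.Theory Num.Theory.
Import numFieldNormedType.Exports.

Set Implicit Arguments.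
Unset Strict Implicit.
Unset Printing Implicit Defensive.

Local Open Scope classical_set_scope.
Local Open Scope ring_scope.

(* (R^d)^{\otimes n}: an element is its family of coefficients, indexed by the
   words of length n.  R^d itself is identified with [tensor R d 1]. *)
Definition tensor (R : realType) (d n : nat) := {ffun n.-tuple 'I_d -> R}.

Section Tensors.
Context {R : realType} {d : nat}.

Definition tnorm n (A : tensor R d n) : R := Num.sqrt (\sum_w A w ^+ 2).

(* The degree of the product is only required to be provably equal to n + m,
   because n + 1 and n.+1 are not convertible for a variable n. *)
Definition tprod n m k (e : (n + m)%N = k)
    (A : tensor R d n) (B : tensor R d m) : tensor R d k :=
  [ffun w : k.-tuple 'I_d =>
     A [tuple tnth w (cast_ord e (lshift m i)) | i < n] *
     B [tuple tnth w (cast_ord e (rshift n j)) | j < m]].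

Definition word_weight (mu : 'rV[R]_d) (w : seq 'I_d) : R := \sum_(i <- w) mu 0 i.

Definition Dop (mu : 'rV[R]_d) (h : R) n (A : tensor R d n) : tensor R d n :=
  [ffun w : n.-tuple 'I_d => expR (- (word_weight mu w * h)) * A w].

End Tensors.

Section Norms.
Context {R : realType} {d : nat}.

(* Functions of time are total; the norms below only look at times in (s, T],
   with s = -oo allowed.  The value 0 is added to the sets so that the supremum
   over an empty set of times is 0 and not -oo. *)
Definition holder_norm (alpha : R) (rho : 'rV[R]_d) (s : \bar R) (T : R) n
    (A : R -> R -> tensor R d n) : \bar R :=
  ereal_sup ([set 0%E] `|`
    [set x | exists u v : R, [/\ (s < u%:E)%E, u < v, v <= T, v - u < 1 &
       x = (tnorm (Dop rho (T - u) (A u v)) / `|v - u| `^ alpha)%:E]]).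

Definition sup_norm (rho : 'rV[R]_d) (s : \bar R) (T : R) n
    (f : R -> tensor R d n) : \bar R :=
  ereal_sup ([set 0%E] `|`
    [set x | exists t : R, [/\ (s < t%:E)%E, t <= T &
       x = (tnorm (Dop rho (T - t) (f t)))%:E]]).

Definition hat_delta (lambda : 'rV[R]_d) n (f : R -> tensor R d n) (u v : R) :
  tensor R d n := f v - Dop lambda (v - u) (f u).

Definition hat_norm (lambda : 'rV[R]_d) (alpha : R) (rho : 'rV[R]_d)
    (s : \bar R) (T : R) n (f : R -> tensor R d n) : \bar R :=
  holder_norm alpha rho s T (hat_delta lambda f).

Definition hatCb (lambda : 'rV[R]_d) (alpha : R) (rho : 'rV[R]_d)
    (s : \bar R) (T : R) n : set (R -> tensor R d n) :=
  [set f | (hat_norm lambda alpha rho s T f + sup_norm rho s T f < +oo)%E].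

End Norms.

Definition rough_pair (R : realType) (d : nat) : Type :=
  ((R -> R -> tensor R d 1) * (R -> R -> tensor R d 2))%type.

Section RoughPaths.
Context {R : realType} {d : nat}.

Definition weighted_rough_path (alpha : R) (rho : 'rV[R]_d) (T : R) :
    set (rough_pair R d) :=
  [set X | [/\
    exists x : R -> tensor R d 1,
      forall s t, s <= t -> t <= T -> X.1 s t = x t - x s,
    (holder_norm alpha rho -oo T X.1 < +oo)%E,
    (holder_norm (2 * alpha) rho -oo T X.2 < +oo)%E &
    forall s u t, s <= u -> u <= t -> t <= T ->
      X.2 s t = X.2 s u + X.2 u t +
                tprod (addn1 1) (X.1 s u) (X.1 u t)]].

End RoughPaths.

Section Convolution.
Context {R : realType} {d : nat}.

(* A partition of [r, t] is given by its points other than r, as in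
   [itv_partition]; its consecutive points are then those of [r :: P]. *)
Definition mesh (r : R) (P : seq R) : R :=
  \big[Num.max/0]_(0 <= k < size P) (nth r (r :: P) k.+1 - nth r (r :: P) k).

(* "|P| -> 0" over the partitions P of [r, t] *)
Definition mesh_to0 (r t : R) : set_system (seq R) :=
  filter_from [set e : R | 0 < e]
    (fun e => [set P | itv_partition r t P /\ mesh r P < e]).

(* Y (x) X^1_{u,v} + Y' (x) X^2_{u,v}.  For n = 0 the second term is absent:
   the derivative Y' is 0 there, and its degree n.-1 is a dummy. *)
Definition rough_increment (X : rough_pair R d) (u v : R) n :
    tensor R d n -> tensor R d n.-1 -> tensor R d n.+1 :=
  match n with
  | 0 => fun Y _ => tprod (addn1 0) Y (X.1 u v)
  | m.+1 => fun Y Y' =>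
      tprod (addn1 m.+1) Y (X.1 u v) + tprod (addn2 m) Y' (X.2 u v)
  end.

Definition rough_sum (lambda : 'rV[R]_d) (X : rough_pair R d) n
    (Y : R -> tensor R d n) (Y' : R -> tensor R d n.-1) (r t : R) (P : seq R) :
    tensor R d n.+1 :=
  \sum_(0 <= k < size P)
    let u := nth r (r :: P) k in let v := nth r (r :: P) k.+1 in
    Dop lambda (t - u) (rough_increment X u v (Y u) (Y' u)).

Definition is_conv (lambda : 'rV[R]_d) (X : rough_pair R d) n
    (Y : R -> tensor R d n) (Y' : R -> tensor R d n.-1) (r t : R)
    (L : tensor R d n.+1) : Prop :=
  tnorm (rough_sum lambda X Y Y' r t P - L) @[P --> mesh_to0 r t] --> (0 : R).

(* The limit if it exists (0 otherwise); limits are unique, see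
   [mesh_to0_proper]. *)
Definition conv_fin (lambda : 'rV[R]_d) (X : rough_pair R d) n
    (Y : R -> tensor R d n) (Y' : R -> tensor R d n.-1) (r t : R) :
    tensor R d n.+1 :=
  xget 0 [set L | is_conv lambda X Y Y' r t L].

Definition is_conv_ninfty (lambda : 'rV[R]_d) (X : rough_pair R d) n
    (Y : R -> tensor R d n) (Y' : R -> tensor R d n.-1) (t : R)
    (L : tensor R d n.+1) : Prop :=
  tnorm (conv_fin lambda X Y Y' r t - L) @[r --> -oo_R] --> (0 : R).

Definition conv (lambda : 'rV[R]_d) (X : rough_pair R d) n
    (Y : R -> tensor R d n) (Y' : R -> tensor R d n.-1) (s : \bar R) (t : R) :
    tensor R d n.+1 :=
  match s with
  | r%:E => conv_fin lambda X Y Y' r t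
  | -oo%E => xget 0 [set L | is_conv_ninfty lambda X Y Y' t L]
  | +oo%E => 0
  end.

Definition conv_exists (lambda : 'rV[R]_d) (X : rough_pair R d) n
    (Y : R -> tensor R d n) (Y' : R -> tensor R d n.-1) (s : \bar R) (t : R) :
    Prop :=
  match s with
  | r%:E => exists L, is_conv lambda X Y Y' r t L
  | -oo%E => (forall r, r <= t -> exists L, is_conv lambda X Y Y' r t L) /\
             exists L, is_conv_ninfty lambda X Y Y' t L
  | +oo%E => False
  end.

End Convolution.

Section Signature.
Context {R : realType} {d : nat}.

Fixpoint efm (lambda : 'rV[R]_d) (X : rough_pair R d) (s : \bar R) (n : nat) :
    R -> tensor R d n :=
  match n return R -> tensor R d n with
  | 0 => fun _ => [ffun=> 1]
  | m.+1 => conv lambda X (efm lambda X s m)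
      (match m return R -> tensor R d m.-1 with
       | 0 => fun _ => 0
       | k.+1 => efm lambda X s k
       end) s
  end.

Definition efm_pred (lambda : 'rV[R]_d) (X : rough_pair R d) (s : \bar R)
    (n : nat) : R -> tensor R d n.-1 :=
  match n return R -> tensor R d n.-1 with
  | 0 => fun _ => 0
  | k.+1 => efm lambda X s k
  end.

Lemma efmS (lambda : 'rV[R]_d) (X : rough_pair R d) (s : \bar R) (n : nat) :
  efm lambda X s n.+1 =
  conv lambda X (efm lambda X s n) (efm_pred lambda X s n) s.
Proof. by []. Qed.

Definition efm_well_defined (lambda : 'rV[R]_d) (X : rough_pair R d) (T : R) :
    Prop :=
  forall (n : nat) (s : \bar R) (t : R), (s <= t%:E)%E -> t <= T ->
    conv_exists lambda X (efm lambda X s n) (efm_pred lambda X s n) s t.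

End Signature.

Lemma mesh_cons (R : realType) (r q : R) (P : seq R) :
  mesh r (q :: P) = Num.max (q - r) (mesh q P).
Proof.
rewrite /mesh big_nat_recl//=; congr Num.max.
by apply: eq_big_nat => k kP; rewrite (set_nth_default q r)/=;
  [rewrite (set_nth_default q r (s := q :: P))//= ltnS ltnW|].
Qed.

Lemma mesh_to0_proper (R : realType) (r t : R) :
  r <= t -> ProperFilter (mesh_to0 r t).
Proof.
move=> rt; apply: filter_from_proper; last first.
  move=> e /= e0.
  have h0 : 0 < e / 2 by rewrite divr_gt0.
  have he : e / 2 < e by rewrite ltr_pdivrMr// ltr_pMr// ltr1n.
  move: (e / 2) h0 he => h h0 he.
  have: exists N : nat, t - r < N%:R * h.
    by exists (Num.truncn ((t - r) / h)).+1; rewrite -ltr_pdivrMr// truncnS_gt.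
  case=> N; elim: N r rt => [|N IH] r rt.
    by rewrite mul0r ltNge subr_ge0 rt.
  rewrite -natr1 mulrDl mul1r => trN.
  have [tr|rt'] := leP t r.
    have -> : t = r by apply/le_anti; rewrite rt tr.
    by exists [::]; split; [split => /= | rewrite /mesh big_nil].
  have [thr|rht] := leP t (r + h).
    exists [:: t]; split; first exact: itv_partition1.
    rewrite mesh_cons /mesh big_nil gt_max e0 andbT ltrBlDl.
    by rewrite (le_lt_trans thr)// ltrD2l.
  have [||P [[pP lP] mP]] := IH (r + h); first exact: ltW.
    by rewrite opprD addrA ltrBlDr.
  exists (r + h :: P); split.
    by split => //=; rewrite ltrDl h0.
  by rewrite mesh_cons gt_max mP andbT addrAC subrr add0r.
apply: filter_from_filter; first by exists 1 => /=.
move=> e f /= e0 f0; exists (Num.min e f) => /=; first by rewrite lt_min e0.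
by move=> P [pP]; rewrite lt_min => /andP[Pe Pf].
Qed.

(* Main.v *)
Require Import Defs.
From mathcomp Require Import all_boot all_order all_algebra.
From mathcomp Require Import all_classical all_reals all_analysis.
From mathcomp Require Import ring lra.
Import Order.TTheory GRing.Theory Num.Theory.
Import numFieldNormedType.Exports.

(** The fading factor disappears after a change of unknown.  For a word [w] put
[F^w_t = e^(lambda^w t) X^w_t], where [X^w_t] is the coefficient of the
signature.  Then [F^(w i)] is the undamped rough integral of the germ
[Xi_(u,v) = F^w_u a^i_(u,v) + F^(w')_u b^(ji)_(u,v)], with [w = w' j],
[a^i_(u,v) = e^(lambda^i u) X^i_(u,v)] and
[b^(ji)_(u,v) = e^((lambda^j + lambda^i) u) X^(ji)_(u,v)], which does not depend
on the final time (rough_sum_rescaled).  With [kappa = lambda - rho > 0] the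
hypotheses on the rough path say that [a^i] is of order
[e^(kappa^i u) |v - u|^alpha] and [b^(ji)] of order
[e^(kappa^(ji) u) |v - u|^(2 alpha)], and the claim is that [F^w] is of order
[e^(kappa^w t)], with increments of order [e^(kappa^w u) |v - u|^alpha].

Induction on the length of the word, carrying also the second order expansion
[F^(w i)_v - F^(w i)_u - F^w_u a^i_(u,v) = O(e^(kappa^(w i) u) |v - u|^(2 alpha))],
gives that the defect of additivity of [Xi] is of order
[e^(kappa u) |v - u|^(3 alpha)] (rough_germ_defect_bounded).  As [3 alpha > 1],
the sewing lemma applies: the Riemann sums converge when the mesh tends to [0],
and the limit differs from [Xi_(u,v)] by the order of the defect (is_sewn_sewn,
is_sewn_bound).  This is the expansion at the next level.

The limit [I_(u,v)] is additive in the interval and is at most [C e^(kappa v)] on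
intervals of length less than [1].  Since [kappa > 0], summing over intervals of
length [1/2] going back in time is a geometric series, so the same bound holds
on every interval (additive_growth).  It makes [I_(r,t)] Cauchy as [r] tends to
[-oo] (cvg_ninfty_additive), and bounds [F] uniformly on the whole half-line,
which is the weighted sup norm. *)

Set Implicit Arguments.
Unset Strict Implicit.
Unset Printing Implicit Defensive.

Local Open Scope classical_set_scope.
Local Open Scope ring_scope.

(** * Sewing a germ along partitions *)

Section Sewing.
Context {R : realType}.
Implicit Types (r t u v m M th : R) (P Q : seq R) (Xi : R -> R -> R).

Fixpoint riemann_sum Xi r P : R :=
  if P is p :: P' then Xi r p + riemann_sum Xi p P' else 0.

(** The recursive form suits inductions along a partition; this is the
    indexed form in which [rough_sum] is written. *)
Lemma riemann_sumE Xi r P : riemann_sum Xi r P =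
  \sum_(0 <= k < size P) Xi (nth r (r :: P) k) (nth r (r :: P) k.+1).
Proof.
elim: P r => [|p P IH] r /=; first by rewrite big_nil.
rewrite big_nat_recl//= IH; congr (_ + _); apply: eq_big_nat => k /andP[_ kP].
by rewrite (set_nth_default r p)/= ?(set_nth_default r p (s := P))// ltnS ltnW.
Qed.

Lemma riemann_sum_cat Xi r P Q :
  riemann_sum Xi r (P ++ Q) = riemann_sum Xi r P + riemann_sum Xi (last r P) Q.
Proof. by elim: P r => [|p P IH] r /=; rewrite ?add0r// IH addrA. Qed.

Definition defect Xi u m v : R := Xi u v - Xi u m - Xi m v.

Definition defect_le Xi th M r t := forall u m v,
  r <= u -> u <= m -> m <= v -> v <= t -> v - u < 1 ->
  `|defect Xi u m v| <= M * (v - u) `^ th.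

(** The solution [K] of [K = 2 + 2 K 2^-th], the recurrence met when an interval
    is halved. *)
Definition sewing_const th : R := 2 / (1 - 2 `^ (1 - th)).

Lemma sewing_const_gt0 th : 1 < th -> 0 < sewing_const th.
Proof.
move=> th1; rewrite divr_gt0// subr_gt0 /powR pnatr_eq0 /=.
by rewrite expR_lt1 pmulr_llt0 ?ln_gt0 ?ltr1n// subr_lt0.
Qed.

Lemma sewing_constE th : 1 < th ->
  2 + 2 * sewing_const th * 2^-1 `^ th = sewing_const th.
Proof.
move=> th1.
have h : 2 `^ (1 - th) = 2 * (2^-1 : R) `^ th.
  rewrite powRD ?pnatr_eq0 ?implybT// powRr1//; congr (_ * _).
  by rewrite -(powR_inv1 (ler0n _ 2)) -powRrM mulN1r.
have : 1 - 2 `^ (1 - th) != 0.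
  by have := sewing_const_gt0 th1; rewrite /sewing_const pmulr_rgt0// invr_gt0 => /lt0r_neq0.
by rewrite /sewing_const h => hn; field.
Qed.

Lemma partition_catE r t P p Q :
  itv_partition r t (P ++ p :: Q) <->
  [/\ itv_partition r (last r P) P, last r P < p & itv_partition p t Q].
Proof.
rewrite /itv_partition cat_path last_cat /= eqxx; split.
  by move=> [/and3P[-> -> ->] ->].
by move=> [[-> _] -> [-> ->]].
Qed.

(** Every Riemann sum stays close to the germ on the whole interval.  The cell
    [[q, p]] that contains the midpoint leaves on each side a partition of an
    interval of at most half the length.  Splitting off the cell costs two
    defects, and the two sides cost by induction [2 K (1/2)^th] times the
    bound, which is a contraction because [th > 1]. *)
Lemma young_bound Xi th M r t : 1 < th -> 0 <= M -> defect_le Xi th M r t ->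
  forall P u v, r <= u -> v <= t -> v - u < 1 -> itv_partition u v P ->
  `|riemann_sum Xi u P - Xi u v| <= sewing_const th * (M * (v - u) `^ th).
Proof.
move=> th1 M0 HX P; have [k] := ubnP (size P); elim: k P => // k IH P sP u v ru vt uv1 puv.
have uv := itv_partition_le puv.
have K0 := sewing_const_gt0 th1.
set K := sewing_const th in K0 *.
case: P sP puv => [_ /itv_partition_nil <- /=|p0 P0 sP puv].
  have := HX u u u ru (lexx _) (lexx _) (le_trans uv vt).
  rewrite /defect !subrr ltr01 sub0r => /(_ isT).
  have th0 : th != 0 by rewrite gt_eqF// (lt_trans _ th1).
  by rewrite powR0// !mulr0 normrN normr_le0 => /eqP ->.
move: sP puv; set P := p0 :: P0 => sP puv.
(* The first point [p] of the partition that is not before the midpoint [c]. *)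
pose c := (u + v) / 2.
have cv : c <= v by rewrite /c; lra.
have uc : u <= c by rewrite /c; lra.
have : has (>= c) P.
  apply/hasP; exists v => //; case: puv => _ /eqP <-.
  by rewrite /P /= mem_last.
move=> hP; case: (split_find hP) sP puv => p P1 P2 /= cp P1c sP.
rewrite cat_rcons => puv.
have [puq qp ppv] := (partition_catE _ _ _ _ _).1 puv.
set q := last u P1 in puq qp *.
have uq := itv_partition_le puq.
have pv := itv_partition_le ppv.
have qc : q <= c.
  rewrite /q; case: (lastP P1) P1c => [//|P1' x]; rewrite last_rcons has_rcons.
  by rewrite negb_or -ltNge => /andP[/ltW].
rewrite riemann_sum_cat /= -/q.
move: sP; rewrite size_cat size_rcons => sP.
have sP1 : (size P1 < k)%N.
  by rewrite -ltnS (leq_trans _ sP)// ltnS addSn ltnS leq_addr.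
have sP2 : (size P2 < k)%N.
  by rewrite -ltnS (leq_trans _ sP)// ltnS addSn ltnS leq_addl.
have e1 := IH _ sP1 u q ru _ _ puq.
have e2 := IH _ sP2 p v _ vt _ ppv.
have {}e1 := e1 ltac:(lra) ltac:(lra).
have {}e2 := e2 ltac:(lra) ltac:(lra).
have d1 := HX u q v ru uq ltac:(lra) vt uv1.
have d2 := HX q p v ltac:(lra) (ltW qp) pv vt ltac:(lra).
have half w : 0 <= w -> w <= (v - u) / 2 -> w `^ th <= (v - u) `^ th * 2^-1 `^ th.
  move=> w0 wl; rewrite -powRM ?subr_ge0// ge0_ler_powR ?nnegrE ?divr_ge0 ?subr_ge0//.
  lra.
have h1 := half (q - u) ltac:(lra) ltac:(rewrite /c in qc; lra).
have h2 := half (v - p) ltac:(lra) ltac:(rewrite /c in cp; lra).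
have h3 : (v - q) `^ th <= (v - u) `^ th.
  rewrite ge0_ler_powR ?nnegrE; lra.
have {}d2 : `|defect Xi q p v| <= M * (v - u) `^ th.
  by apply: (le_trans d2); rewrite ler_wpM2l.
have {}e1 : `|riemann_sum Xi u P1 - Xi u q| <= K * (M * ((v - u) `^ th * 2^-1 `^ th)).
  by apply: (le_trans e1); rewrite ler_wpM2l ?(ltW K0)// ler_wpM2l.
have {}e2 : `|riemann_sum Xi p P2 - Xi p v| <= K * (M * ((v - u) `^ th * 2^-1 `^ th)).
  by apply: (le_trans e2); rewrite ler_wpM2l ?(ltW K0)// ler_wpM2l.
have -> : riemann_sum Xi u P1 + (Xi q p + riemann_sum Xi p P2) - Xi u v =
  (riemann_sum Xi u P1 - Xi u q) + (riemann_sum Xi p P2 - Xi p v)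
  - defect Xi u q v - defect Xi q p v by rewrite /defect; ring.
rewrite -[X in _ <= X * _](sewing_constE th1) -/K.
apply: (le_trans (ler_normB _ _)); apply: (le_trans (lerD (ler_normB _ _) d2)).
apply: (le_trans (lerD (lerD (ler_normD _ _) d1) (lexx _))).
apply: (le_trans (lerD (lerD (lerD e1 e2) (lexx _)) (lexx _))).
lra.
Qed.

Lemma mesh_ge0 r P : 0 <= mesh r P.
Proof.
by rewrite /mesh; elim/big_rec : _ => // k x _ x0; rewrite le_max x0 orbT.
Qed.

Lemma itv_partition_mem r t P x : itv_partition r t P -> x \in P -> r < x <= t.
Proof.
move=> h xP; case/splitPr: xP h => P1 P2.
move=> /partition_catE[/itv_partition_le h1 h2 /itv_partition_le ->].
by rewrite (le_lt_trans h1 h2).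
Qed.

(** Each cell of [P] contributes the error of [young_bound]; a cell of length
    [h < e] has [h^th <= e^(th - 1) h], and the lengths sum up to [t - r]. *)
Lemma riemann_sum_refine Xi th M e r t P Q : 1 < th -> 0 <= M -> defect_le Xi th M r t ->
  e <= 1 -> itv_partition r t P -> mesh r P < e ->
  itv_partition r t Q -> {subset P <= Q} ->
  `|riemann_sum Xi r Q - riemann_sum Xi r P| <=
    sewing_const th * M * e `^ (th - 1) * (t - r).
Proof.
move=> th1 M0 HX e1; have K0 := sewing_const_gt0 th1.
elim: P r Q HX => [|p P IH] r Q HX hP mP hQ PQ.
  move/itv_partition_nil : hP hQ => -> /itv_partitionxx -> /=.
  by rewrite !subrr normr0 mulr0.
have pQ : p \in Q by rewrite PQ// mem_head.
have [_ rp hP'] := (@partition_catE r t [::] p P).1 hP.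
move: mP; rewrite mesh_cons gt_max => /andP[pre mP].
case/splitPr: pQ hQ PQ => Q1 Q2 hQ PQ.
have [h1 h2 h3] := (partition_catE _ _ _ _ _).1 hQ.
have pt := itv_partition_le h3.
rewrite -cat_rcons riemann_sum_cat last_rcons /=.
have HX' : defect_le Xi th M p t.
  by move=> u m v pu um mv vt uv1; apply: HX => //; exact: le_trans (ltW rp) pu.
have sub : {subset P <= Q2}.
  move=> x xP; have := PQ x; rewrite inE xP orbT => /(_ isT).
  have /andP[px _] := itv_partition_mem hP' xP.
  rewrite mem_cat inE (gt_eqF px) /= => /orP[xQ1|//].
  have /andP[_ xl] := itv_partition_mem h1 xQ1.
  by have := lt_trans (le_lt_trans xl h2) px; rewrite ltxx.
have b2 := IH p Q2 HX' hP' mP h3 sub.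
have hQ1 : itv_partition r p (rcons Q1 p).
  by rewrite -cats1; apply/partition_catE; split => //; split => /=.
have b1 := young_bound th1 M0 HX (lexx r) pt (lt_le_trans pre e1) hQ1.
have {}b1 : `|riemann_sum Xi r (rcons Q1 p) - Xi r p| <=
    sewing_const th * M * e `^ (th - 1) * (p - r).
  apply: (le_trans b1); rewrite -[_ * M * _]mulrA -mulrA.
  apply: ler_wpM2l; first exact: ltW.
  rewrite -mulrA; apply: ler_wpM2l => //.
  have pr0 : 0 < p - r by rewrite subr_gt0.
  rewrite -(mulr_powRB1 (ltW pr0) (lt_trans ltr01 th1)) mulrC ler_wpM2r ?(ltW pr0)//.
  rewrite ge0_ler_powR ?nnegrE ?subr_ge0 ?(ltW th1) ?(ltW rp)// ?ltW//.
  exact: lt_trans pr0 pre.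
rewrite opprD addrACA.
apply: (le_trans (ler_normD _ _)); apply: (le_trans (lerD b1 b2)).
lra.
Qed.

(** This is what compares two arbitrary partitions: both Riemann sums are close
    to that of a common refinement. *)
Lemma common_refinement r t P Q : itv_partition r t P -> itv_partition r t Q ->
  exists2 S, itv_partition r t S & {subset P <= S} /\ {subset Q <= S}.
Proof.
move=> hP hQ.
have [rt|tr|rt] := ltgtP r t; last 1 first.
- by move: hP hQ; rewrite -rt => /itv_partitionxx -> /itv_partitionxx ->; exists [::].
- exists (sort <=%R (undup (P ++ Q))); last first.
    by split => x; rewrite mem_sort mem_undup mem_cat => ->; rewrite ?orbT.
  set S := sort _ _.
  have memS x : (x \in S) = (x \in P) || (x \in Q) by rewrite mem_sort mem_undup mem_cat.
  have hS x : x \in S -> r < x <= t.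
    by rewrite memS => /orP[/(itv_partition_mem hP)|/(itv_partition_mem hQ)].
  have sS : path <%R r S.
    rewrite path_min_sorted; last by apply/allP => x /hS/andP[].
    by rewrite lt_sorted_uniq_le sort_uniq undup_uniq sort_le_sorted.
  have tS : t \in S.
    rewrite memS; case: hP => _ /eqP lP; case: (P) lP => [/= E|p P' /= <-].
      by rewrite E ltxx in rt.
    by rewrite mem_last.
  split => //; have lS := mem_last r S.
  have lt_ : last r S <= t.
    by move: lS; rewrite inE => /orP[/eqP ->|/hS/andP[]//]; exact: ltW.
  rewrite eq_le lt_ /=; case/splitPr: tS sS => S1 S2.
  rewrite cat_path last_cat /= => /and3P[_ _ h].
  exact: (itv_partition_le (conj h (eqxx _))).
- by have := itv_partition_le hP; rewrite leNgt tr.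
Qed.

Definition is_sewn Xi r t (L : R) := riemann_sum Xi r P @[P --> mesh_to0 r t] --> L.

Definition sewn Xi r t : R := lim (riemann_sum Xi r P @[P --> mesh_to0 r t]).

(** Existence of the limit in the sewing lemma: through common refinements, the
    Riemann sums form a Cauchy filter as the mesh tends to [0]. *)
Lemma is_sewn_sewn Xi th M r t : 1 < th -> 0 <= M -> defect_le Xi th M r t -> r <= t ->
  is_sewn Xi r t (sewn Xi r t).
Proof.
move=> th1 M0 HX rt; have FF := mesh_to0_proper rt.
have K0 := sewing_const_gt0 th1.
suff : cvg (riemann_sum Xi r P @[P --> mesh_to0 r t]) by [].
apply: cauchy_cvg; apply: cauchy_exP => e e0.
pose C := sewing_const th * M * (t - r) + 1.
have C0 : 0 < C by rewrite ltr_wpDl// mulr_ge0 ?subr_ge0// mulr_ge0// ltW.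
have eC : 0 < e / (2 * C) by rewrite divr_gt0// mulr_gt0.
(* Below this mesh the error [C d^(th - 1)] of a refinement is at most [e / 2]. *)
pose d := Num.min 1 ((e / (2 * C)) `^ (th - 1)^-1).
have d0 : 0 < d by rewrite lt_min ltr01 powR_gt0.
have dC : d `^ (th - 1) <= e / (2 * C).
  have -> : e / (2 * C) = ((e / (2 * C)) `^ (th - 1)^-1) `^ (th - 1).
    by rewrite -powRrM mulVf ?subr_eq0 ?gt_eqF// powRr1 ?ltW.
  rewrite ge0_ler_powR ?nnegrE ?powR_ge0 ?subr_ge0 ?(ltW d0) ?(ltW th1)//.
  by rewrite ge_min lexx orbT.
have close P S : itv_partition r t P -> mesh r P < d -> itv_partition r t S ->
    {subset P <= S} -> `|riemann_sum Xi r S - riemann_sum Xi r P| < e / 2.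
  move=> hP mP hS PS.
  have d1 : d <= 1 by rewrite ge_min lexx.
  apply: (le_lt_trans (riemann_sum_refine th1 M0 HX d1 hP mP hS PS)).
  rewrite mulrAC.
  have -> : e / 2 = C * (e / (2 * C)) by field; rewrite gt_eqF.
  apply: (@le_lt_trans _ _ (sewing_const th * M * (t - r) * (e / (2 * C)))).
    by rewrite ler_wpM2l// mulr_ge0 ?subr_ge0// mulr_ge0// ltW.
  by rewrite ltr_pM2r// /C ltrDl.
have [P0 [hP0 mP0]] : exists P, itv_partition r t P /\ mesh r P < d.
  apply: (@filter_ex _ (mesh_to0 r t)); exists d => //=.
exists (riemann_sum Xi r P0); exists d => // P [hP mP].
have [S hS [P0S PS]] := common_refinement hP0 hP.
have b0 := close _ _ hP0 mP0 hS P0S; have b := close _ _ hP mP hS PS.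
rewrite /ball /= -[X in X < _]/(`|_|).
have -> : riemann_sum Xi r P0 - riemann_sum Xi r P =
  (riemann_sum Xi r S - riemann_sum Xi r P) - (riemann_sum Xi r S - riemann_sum Xi r P0) by ring.
apply: (le_lt_trans (ler_normB _ _)); lra.
Qed.

Lemma is_sewn_uniq Xi r t (L L' : R) : r <= t -> is_sewn Xi r t L -> is_sewn Xi r t L' -> L = L'.
Proof.
move=> rt h h'; have FF := mesh_to0_proper rt.
exact: (cvg_unique _ h h').
Qed.

Lemma mesh_cat r t P Q : itv_partition r t P ->
  mesh r (P ++ Q) = Num.max (mesh r P) (mesh t Q).
Proof.
elim: P r => [r /itv_partition_nil ->/=|p P IH r hP].
  by rewrite [X in Num.max X]/mesh big_nil max_r ?mesh_ge0.
by rewrite /= !mesh_cons (IH p) ?maxA//; have [] := itv_partition_cons hP.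
Qed.

(** Concatenating fine partitions of the two halves gives a fine partition of the
    whole interval. *)
Lemma is_sewn_add Xi r m t (L L1 L2 : R) : r <= m -> m <= t ->
  is_sewn Xi r t L -> is_sewn Xi r m L1 -> is_sewn Xi m t L2 -> L = L1 + L2.
Proof.
move=> rm mt h h1 h2; have FF1 := mesh_to0_proper rm; have FF2 := mesh_to0_proper mt.
have FF := mesh_to0_proper (le_trans rm mt).
apply/eqP; rewrite -subr_eq0 -normr_le0; apply/ler_addgt0Pl => e e0; rewrite addr0.
have e30 : 0 < e / 3 by rewrite divr_gt0.
have near3 (F : set_system (seq R)) (FFF : Filter F) f (l : R) :
    f P @[P --> F] --> l -> \forall P \near F, `|l - f P| <= e / 3.
  by move=> /cvgrPdist_le; exact.
have [d /= d0 hd] := near3 _ _ _ _ h.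
have [P1 [b1 [p1 m1]]] : exists P, `|L1 - riemann_sum Xi r P| <= e / 3 /\
    (itv_partition r m P /\ mesh r P < d).
  by apply: (@filter_ex _ (mesh_to0 r m)); apply: filterI; [exact: (near3 _ _ _ _ h1)|exists d].
have [P2 [b2 [p2 m2]]] : exists P, `|L2 - riemann_sum Xi m P| <= e / 3 /\
    (itv_partition m t P /\ mesh m P < d).
  by apply: (@filter_ex _ (mesh_to0 m t)); apply: filterI; [exact: (near3 _ _ _ _ h2)|exists d].
have := hd (P1 ++ P2); rewrite /= (mesh_cat _ p1) gt_max m1 m2.
move=> /(_ (conj (itv_partition_cat p1 p2) isT)).
rewrite riemann_sum_cat (eqP p1.2) => b.
have -> : L - (L1 + L2) = (L - (riemann_sum Xi r P1 + riemann_sum Xi m P2))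
   - (L1 - riemann_sum Xi r P1) - (L2 - riemann_sum Xi m P2) by ring.
apply: (le_trans (ler_normB _ _)); apply: (le_trans (lerD (ler_normB _ _) (lexx _))).
lra.
Qed.

Lemma is_sewn_bound Xi th M r t L : 1 < th -> 0 <= M -> defect_le Xi th M r t ->
  r <= t -> t - r < 1 -> is_sewn Xi r t L ->
  `|L - Xi r t| <= sewing_const th * (M * (t - r) `^ th).
Proof.
move=> th1 M0 HX rt tr1 h; have FF := mesh_to0_proper rt.
have h' : `|riemann_sum Xi r P - Xi r t| @[P --> mesh_to0 r t] --> `|L - Xi r t|.
  by apply: cvg_norm; apply: cvgB => //; exact: cvg_cst.
apply: (cvgr_to_le h'); exists 1 => //= P [hP _].
exact: (young_bound th1 M0 HX).
Qed.

End Sewing.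

(** * Bounds with an exponential weight and a Hoelder exponent *)

Section Bounded.
Context {R : realType} (s : \bar R) (T : R).
Implicit Types (c e : R) (G : R -> R -> R -> R) (A : R -> R -> R).

(** The calculus of estimates: order [e^(c u) (v - u)^e] on the intervals of
    length less than [1].  The middle time [m] is there for the defects of
    additivity, where products mix increments over [[u, m]] and over
    [[m, v]]. *)
Definition bounded3 c e G := exists2 C, 0 <= C & forall u m v,
  (s <= u%:E)%E -> u <= m -> m <= v -> v <= T -> v - u < 1 ->
  `|G u m v| <= C * (expR (c * u) * (v - u) `^ e).

Definition bounded2 c e A := bounded3 c e (fun u _ v => A u v).

Lemma bounded3_eq c e G G' : (forall u m v, (s <= u%:E)%E -> u <= m -> m <= v ->
  v <= T -> G u m v = G' u m v) -> bounded3 c e G -> bounded3 c e G'.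
Proof.
move=> GG' [C C0 hC]; exists C => // u m v su um mv vT uv.
by rewrite -GG'// hC.
Qed.

Lemma bounded3N c e G : bounded3 c e G -> bounded3 c e (fun u m v => - G u m v).
Proof.
by move=> [C C0 hC]; exists C => // u m v su um mv vT uv; rewrite normrN hC.
Qed.

Lemma bounded3D c e G G' : bounded3 c e G -> bounded3 c e G' ->
  bounded3 c e (fun u m v => G u m v + G' u m v).
Proof.
move=> [C C0 hC] [D D0 hD]; exists (C + D); first exact: addr_ge0.
move=> u m v su um mv vT uv; rewrite mulrDl.
by apply: (le_trans (ler_normD _ _)); rewrite lerD ?hC ?hD.
Qed.

Lemma bounded3M c e c' e' G G' : 0 <= e -> 0 <= e' ->
  bounded3 c e G -> bounded3 c' e' G' ->
  bounded3 (c + c') (e + e') (fun u m v => G u m v * G' u m v).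
Proof.
move=> e0 e'0 [C C0 hC] [D D0 hD]; exists (C * D); first exact: mulr_ge0.
move=> u m v su um mv vT uv; rewrite normrM.
have -> : (v - u) `^ (e + e') = (v - u) `^ e * (v - u) `^ e'.
  have [ee|ee] := eqVneq (e + e') 0; last by rewrite powRD// (negPf ee).
  have [-> ->] : e = 0 /\ e' = 0 by split; lra.
  by rewrite addr0 powRr0 mulr1.
rewrite mulrDl expRD.
have -> (x y z w : R) : C * D * (x * y * (z * w)) = (C * (x * z)) * (D * (y * w)) by ring.
by rewrite ler_pM ?hC ?hD.
Qed.

Lemma bounded3_weaken c e e' G : 0 <= e' -> e' <= e -> bounded3 c e G -> bounded3 c e' G.
Proof.
move=> e'0 ee' [C C0 hC]; exists C => // u m v su um mv vT uv.
apply: (le_trans (hC _ _ _ su um mv vT uv)); rewrite ler_wpM2l// ler_wpM2l ?expR_ge0//.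
have [->|vu] := eqVneq (v - u) 0.
  have [->|e'N0] := eqVneq e' 0; last by rewrite !powR0//; lra.
  by rewrite powRr0 /powR eqxx lern1 leq_b1.
by rewrite ger_powR//; lra.
Qed.

Lemma bounded3_left c e A : 0 <= e -> bounded2 c e A -> bounded3 c e (fun u m _ => A u m).
Proof.
move=> e0 [C C0 hC]; exists C => // u m v su um mv vT uv.
have := hC u m m su um (lexx _) (le_trans mv vT) ltac:(lra).
move/le_trans; apply; rewrite ler_wpM2l// ler_wpM2l ?expR_ge0//.
by rewrite ge0_ler_powR ?nnegrE//; lra.
Qed.

(** Moving the weight from [m] back to [u] costs the factor [e^c] only, since
    [m - u < 1]. *)
Lemma bounded3_right c e A : 0 <= c -> 0 <= e -> bounded2 c e A ->
  bounded3 c e (fun _ m v => A m v).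
Proof.
move=> c0 e0 [C C0 hC]; exists (C * expR c); first by rewrite mulr_ge0 ?expR_ge0.
move=> u m v su um mv vT uv.
have sm : (s <= m%:E)%E by rewrite (le_trans su)// lee_fin.
have := hC m m v sm (lexx _) mv vT ltac:(lra).
move/le_trans; apply; rewrite -mulrA ler_wpM2l// mulrA -expRD.
rewrite ler_pM ?expR_ge0 ?powR_ge0//; last by rewrite ge0_ler_powR ?nnegrE//; lra.
rewrite ler_expR; have : 0 <= c * (1 - (m - u)) by rewrite mulr_ge0//; lra.
lra.
Qed.

Lemma defect_le_bounded Xi c e : 0 <= c -> bounded3 c e (defect Xi) ->
  exists2 C, 0 <= C & forall r t, (s <= r%:E)%E -> t <= T ->
    defect_le Xi e (C * expR (c * t)) r t.
Proof.
move=> c0 [C C0 hC]; exists C => // r t sr tT u m v ru um mv vt uv.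
have su : (s <= u%:E)%E by rewrite (le_trans sr)// lee_fin.
apply: (le_trans (hC _ _ _ su um mv (le_trans vt tT) uv)).
rewrite -mulrA ler_wpM2l// ler_wpM2r ?powR_ge0// ler_expR ler_wpM2l//.
exact: le_trans um (le_trans mv vt).
Qed.

(** On an interval of length less than [1] the weight at its right end, used as a
    uniform bound for the defects inside, is comparable to the weight at its left
    end. *)
Lemma sewn_bounded Xi c th : 1 < th -> 0 <= c -> bounded3 c th (defect Xi) ->
  (forall r t, (s <= r%:E)%E -> r <= t -> t <= T -> is_sewn Xi r t (sewn Xi r t)) /\
  bounded2 c th (fun u v => sewn Xi u v - Xi u v).
Proof.
move=> th1 c0 /(defect_le_bounded c0)[C C0 hC].
have sw r t : (s <= r%:E)%E -> r <= t -> t <= T -> is_sewn Xi r t (sewn Xi r t).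
  by move=> sr rt tT; apply: is_sewn_sewn (hC r t sr tT) rt => //; rewrite mulr_ge0 ?expR_ge0.
split=> //.
have K0 := sewing_const_gt0 th1.
exists (sewing_const th * (C * expR c)).
  by rewrite mulr_ge0 ?(ltW K0)// mulr_ge0 ?expR_ge0.
move=> u m v su um mv vT uv; have uv' := le_trans um mv.
have M0 : 0 <= C * expR (c * v) by rewrite mulr_ge0 ?expR_ge0.
have := is_sewn_bound th1 M0 (hC u v su vT) uv' uv (sw u v su uv' vT).
move/le_trans; apply; rewrite -[leRHS]mulrA; apply: ler_wpM2l; first exact: ltW.
rewrite mulrA ler_wpM2r ?powR_ge0// -mulrA ler_wpM2l// -expRD ler_expR.
have : 0 <= c * (1 - (v - u)) by rewrite mulr_ge0//; lra.
lra.
Qed.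

(** The local bound propagates to intervals of any length: with
    [D = C + D e^(- c/2)], going back by one step of length [1/2] reproduces
    [D e^(c v)]. *)
Lemma additive_growth (I : R -> R -> R) c e : 0 < c -> 0 <= e ->
  (forall u m v, (s <= u%:E)%E -> u <= m -> m <= v -> v <= T -> I u v = I u m + I m v) ->
  bounded2 c e I ->
  exists2 D, 0 <= D & forall u v, (s <= u%:E)%E -> u <= v -> v <= T ->
    `|I u v| <= D * expR (c * v).
Proof.
move=> c0 e0 addI [C C0 hC].
have q0 : 0 < 1 - expR (- (c / 2)).
  by rewrite subr_gt0 expR_lt1 oppr_lt0 divr_gt0.
pose D := C / (1 - expR (- (c / 2))).
have D0 : 0 <= D by rewrite divr_ge0// ltW.
have CD : C + D * expR (- (c / 2)) = D by rewrite /D; field; rewrite gt_eqF.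
exists D => // u v su uv vT.
have short w z : (s <= w%:E)%E -> w <= z -> z <= T -> z - w < 1 -> `|I w z| <= C * expR (c * z).
  move=> sw wz zT zw.
  apply: (le_trans (hC _ w _ sw (lexx _) wz zT zw)); rewrite ler_wpM2l//.
  rewrite -[leRHS]mulr1 ler_pM ?expR_ge0 ?powR_ge0//; first by rewrite ler_expR ler_wpM2l// ltW.
  have <- : (1 : R) `^ e = 1 by rewrite powR1.
  rewrite ge0_ler_powR ?nnegrE//; lra.
have [N] : exists N : nat, v - u < N%:R * (1 / 2).
  by exists (Num.truncn ((v - u) / (1 / 2))).+1; rewrite -ltr_pdivrMr// truncnS_gt.
elim: N v uv vT => [|N IH] v uv vT; first by rewrite mul0r; lra.
rewrite -natr1 mulrDl mul1r => uvN.
have [vu|vu] := ltP (v - u) 1.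
  apply: (le_trans (short _ _ su uv vT vu)); rewrite ler_wpM2r ?expR_ge0//.
  by rewrite -CD ler_wpDr// mulr_ge0 ?expR_ge0.
have i1 := IH (v - 1 / 2) ltac:(lra) ltac:(lra) ltac:(lra).
have sv : (s <= (v - 1 / 2)%:E)%E by rewrite (le_trans su)// lee_fin; lra.
have i2 := short (v - 1 / 2) v sv ltac:(lra) vT ltac:(lra).
rewrite (addI u (v - 1 / 2) v)//; [|lra|lra].
apply: (le_trans (ler_normD _ _)); apply: (le_trans (lerD i1 i2)).
have -> : c * (v - 1 / 2) = - (c / 2) + c * v by ring.
rewrite expRD -[X in _ <= X * _]CD; lra.
Qed.

End Bounded.

(** By additivity two values at [r <= r0] differ by [I r r0], which is at most
    [D e^(c r0)]. *)
Lemma cvg_ninfty_additive (R : realType) (T : R) (I : R -> R -> R) c D t : 0 < c -> 0 <= D ->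
  (forall u m v, u <= m -> m <= v -> v <= T -> I u v = I u m + I m v) ->
  (forall u v, u <= v -> v <= T -> `|I u v| <= D * expR (c * v)) ->
  t <= T -> exists L, I r t @[r --> -oo_R] --> (L : R).
Proof.
move=> c0 D0 addI hI tT.
suff : cvg (I r t @[r --> -oo_R]) by move=> h; exists (lim (I r t @[r --> -oo_R])).
apply: cauchy_cvg; apply: cauchy_exP => e e0.
have eD : 0 < e / (D + 1) by rewrite divr_gt0// ltr_wpDl.
(* This choice gives [(D + 1) e^(c r0) <= e]. *)
pose r0 := Num.min t (ln (e / (D + 1)) / c).
have r0t : r0 <= t by rewrite ge_min lexx.
have hr0 : D * expR (c * r0) < e.
  have : expR (c * r0) <= e / (D + 1).
    rewrite -[leRHS]lnK ?posrE// ler_expR mulrC -ler_pdivlMr//.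
    by rewrite ge_min lexx orbT.
  rewrite ler_pdivlMr ?ltr_wpDl// mulrDr mulr1 mulrC => h.
  by apply: lt_le_trans h; rewrite ltrDl expR_gt0.
exists (I r0 t); exists r0; split; first exact: num_real.
move=> r rr0; rewrite /ball /= -[X in X < _]/(`|_|).
rewrite (addI r r0 t)//; last exact: ltW.
rewrite opprD addrCA subrr addr0 normrN (le_lt_trans _ hr0)// hI ?(ltW rr0)//.
exact: le_trans tT.
Qed.

(** * The germ of a rough integral *)

Section RoughGerm.
Context {R : realType} (s : \bar R) (T alpha : R).
Hypothesis halpha : 3^-1 < alpha <= 2^-1.
Local Notation bounded2 := (bounded2 s T).
Local Notation bounded3 := (bounded3 s T).

Definition weighted_holder c (F : R -> R) :=
  bounded2 c 0 (fun u _ => F u) /\ bounded2 c alpha (fun u v => F v - F u).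

Definition rough_germ (f g : R -> R) (a b : R -> R -> R) u v : R :=
  f u * a u v + g u * b u v.

(** The factor relating weights taken at [u] and at [m]:
    [e^(l u) = decay l u m * e^(l m)]. *)
Definition decay (l u m : R) : R := expR (- (l * (m - u))).

Lemma decay_sub1_bounded l : 0 <= l -> bounded2 0 1 (fun u m => decay l u m - 1).
Proof.
move=> l0; exists l => // u m v _ um mv _ _; have uv := le_trans um mv.
rewrite mul0r expR0 mul1r powRr1 ?subr_ge0// distrC ger0_norm ?subr_ge0.
  by have := expR_ge1Dx (- (l * (v - u))); rewrite /decay; lra.
by rewrite expR_le1 oppr_le0 mulr_ge0 ?subr_ge0.
Qed.

(** Here [f] is controlled by [ay] with derivative [g], and [b] is the iterated
    integral of [ay] against [a] up to the decay factors.  As for unweighted rough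
    integrals, the terms of order below [3 alpha] cancel, and what remains is
    - the remainder of [f] times [a] and the increment of [g] times [b], of
      order [3 alpha];
    - terms with a factor [decay - 1], of order [1 >= 2 alpha], times a factor of
      order at least [alpha]. *)
Lemma rough_germ_defect_bounded (cg cy cx ly lx : R) (f g : R -> R) (a ay b : R -> R -> R) :
  0 <= cy -> 0 <= cx -> 0 <= ly -> 0 <= lx ->
  bounded2 cx alpha a -> bounded2 cy alpha ay ->
  bounded2 (cy + cx) (2 * alpha) b ->
  (forall u m v, u <= m -> m <= v -> v <= T ->
     a u v = a u m + decay lx u m * a m v) ->
  (forall u m v, u <= m -> m <= v -> v <= T ->
     b u v = b u m + decay (ly + lx) u m * b m v + ay u m * (decay lx u m * a m v)) ->
  weighted_holder cg g -> weighted_holder (cg + cy) f ->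
  bounded2 (cg + cy) (2 * alpha) (fun u v => f v - f u - g u * ay u v) ->
  bounded3 (cg + cy + cx) (3 * alpha) (defect (rough_germ f g a b)).
Proof.
move=> cy0 cx0 ly0 lx0 ha hay hb a_split b_split [g0 g1] [f0 f1] f2.
have /andP[a13 a12] := halpha.
have a0 : 0 <= alpha by lra.
have a20 : 0 <= 2 * alpha by lra.
have am := bounded3_right cx0 a0 ha.
have bm := bounded3_right (addr_ge0 cy0 cx0) a20 hb.
have aym := bounded3_left a0 hay.
have gu := bounded3_left (lexx _) g0.
have fu := bounded3_left (lexx _) f0.
have dgm := bounded3_left a0 g1.
have rem := bounded3_left a20 f2.
have phi := bounded3_left ler01 (decay_sub1_bounded lx0).
have psi := bounded3_left ler01 (decay_sub1_bounded (addr_ge0 ly0 lx0)).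
have to3a c c' e G : c = c' -> 3 * alpha <= e -> bounded3 c e G -> bounded3 c' (3 * alpha) G.
  by move=> -> ea; apply: bounded3_weaken => //; lra.
have t1 : bounded3 (cg + cy + cx) (3 * alpha)
    (fun u m v => f u * ((decay lx u m - 1) * a m v)).
  by apply: to3a (bounded3M _ _ fu (bounded3M _ _ phi am)); lra.
have t2 : bounded3 (cg + cy + cx) (3 * alpha)
    (fun u m v => g u * ((decay (ly + lx) u m - 1) * b m v)).
  by apply: to3a (bounded3M _ _ gu (bounded3M _ _ psi bm)); lra.
have t3 : bounded3 (cg + cy + cx) (3 * alpha)
    (fun u m v => (g u * ay u m) * ((decay lx u m - 1) * a m v)).
  by apply: to3a (bounded3M _ _ (bounded3M _ _ gu aym) (bounded3M _ _ phi am)); lra.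
have t4 : bounded3 (cg + cy + cx) (3 * alpha)
    (fun u m v => - ((f m - f u - g u * ay u m) * a m v)).
  by apply: to3a (bounded3N (bounded3M _ _ rem am)); lra.
have t5 : bounded3 (cg + cy + cx) (3 * alpha)
    (fun u m v => - ((g m - g u) * b m v)).
  by apply: to3a (bounded3N (bounded3M _ _ dgm bm)); lra.
have := bounded3D (bounded3D (bounded3D (bounded3D t1 t2) t3) t4) t5.
apply: bounded3_eq => u m v su um mv vT.
rewrite /defect /rough_germ (a_split u m v)// (b_split u m v)//.
by ring.
Qed.

Lemma sewn_additive Xi c th : 1 < th -> 0 <= c -> bounded3 c th (defect Xi) ->
  forall u m v, (s <= u%:E)%E -> u <= m -> m <= v -> v <= T ->
    sewn Xi u v = sewn Xi u m + sewn Xi m v.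
Proof.
move=> th1 c0 /(sewn_bounded th1 c0)[sw _] u m v su um mv vT.
have sm : (s <= m%:E)%E by rewrite (le_trans su)// lee_fin.
by apply: (is_sewn_add um mv); apply: sw => //; [exact: le_trans um mv | exact: le_trans mv vT].
Qed.

(** The sewn germ is at short range dominated by its leading term [A], of order
    [alpha]. *)
Lemma sewn_growth Xi A c : 0 < c -> bounded3 c (3 * alpha) (defect Xi) ->
  bounded2 c (2 * alpha) (fun u v => Xi u v - A u v) -> bounded2 c alpha A ->
  exists2 D, 0 <= D & forall u v, (s <= u%:E)%E -> u <= v -> v <= T ->
    `|sewn Xi u v| <= D * expR (c * v).
Proof.
move=> c0 hXi hXiA hA; have /andP[a13 a12] := halpha.
have th1 : 1 < 3 * alpha by lra.
have [_ h] := sewn_bounded th1 (ltW c0) hXi.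
apply: (@additive_growth _ _ _ _ _ alpha) => //; first lra.
  exact: (sewn_additive th1 (ltW c0) hXi).
have {}h : bounded2 c alpha (fun u v => sewn Xi u v - Xi u v).
  by apply: bounded3_weaken h; lra.
have {}hXiA : bounded2 c alpha (fun u v => Xi u v - A u v).
  by apply: bounded3_weaken hXiA; lra.
have := bounded3D (bounded3D h hXiA) hA.
by apply: bounded3_eq => *; ring.
Qed.

(** A primitive of the germ inherits the expansion of the germ, because the
    sewing error has the higher order [3 alpha]. *)
Lemma primitive_controlled Xi A c F D : 0 < c -> bounded3 c (3 * alpha) (defect Xi) ->
  bounded2 c (2 * alpha) (fun u v => Xi u v - A u v) -> bounded2 c alpha A ->
  (forall u v, (s <= u%:E)%E -> u <= v -> v <= T -> F v - F u = sewn Xi u v) ->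
  0 <= D -> (forall t, (s <= t%:E)%E -> t <= T -> `|F t| <= D * expR (c * t)) ->
  weighted_holder c F /\ bounded2 c (2 * alpha) (fun u v => F v - F u - A u v).
Proof.
move=> c0 hXi hXiA hA FI D0 FD; have /andP[a13 a12] := halpha.
have th1 : 1 < 3 * alpha by lra.
have [_ h] := sewn_bounded th1 (ltW c0) hXi.
have h2 : bounded2 c (2 * alpha) (fun u v => F v - F u - A u v).
  have {}h : bounded2 c (2 * alpha) (fun u v => sewn Xi u v - Xi u v).
    by apply: bounded3_weaken h; lra.
  apply: bounded3_eq (bounded3D h hXiA) => u m v su um mv vT.
  by rewrite FI//; [ring|exact: le_trans mv].
split => //; split.
  exists D => // u m v su um mv vT uv.
  by rewrite powRr0 mulr1 FD// (le_trans um)// (le_trans mv).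
have {}h2 : bounded2 c alpha (fun u v => F v - F u - A u v).
  by apply: bounded3_weaken h2; lra.
by apply: bounded3_eq (bounded3D h2 hA) => u m v *; ring.
Qed.

End RoughGerm.

(** * Words and coefficients of tensors *)

Section Words.
Context {R : realType} {d : nat}.

Definition wleft n m k (e : (n + m)%N = k) (w : k.-tuple 'I_d) : n.-tuple 'I_d :=
  [tuple tnth w (cast_ord e (lshift m i)) | i < n].

Definition wright n m k (e : (n + m)%N = k) (w : k.-tuple 'I_d) : m.-tuple 'I_d :=
  [tuple tnth w (cast_ord e (rshift n j)) | j < m].

Lemma tprodE n m k (e : (n + m)%N = k) (A : tensor R d n) (B : tensor R d m) w :
  tprod e A B w = A (wleft e w) * B (wright e w).
Proof. by rewrite ffunE. Qed.

Lemma word_weight_split (mu : 'rV[R]_d) n m k (e : (n + m)%N = k) (w : k.-tuple 'I_d) :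
  word_weight mu w = word_weight mu (wleft e w) + word_weight mu (wright e w).
Proof.
case: k / e w => w; rewrite /word_weight !big_tuple big_split_ord /=.
by congr (_ + _); apply: eq_bigr => i _; rewrite tnth_mktuple cast_ord_id.
Qed.

Lemma wleft_wleft n (w : n.+2.-tuple 'I_d) :
  wleft (addn1 n) (wleft (addn1 n.+1) w) = wleft (addn2 n) w.
Proof.
by apply: eq_from_tnth => i; rewrite !tnth_mktuple; congr tnth; apply: val_inj.
Qed.

Lemma wright_wleft n (w : n.+2.-tuple 'I_d) :
  wright (addn1 n) (wleft (addn1 n.+1) w) = wleft (addn1 1) (wright (addn2 n) w).
Proof.
by apply: eq_from_tnth => i; rewrite !tnth_mktuple; congr tnth; apply: val_inj.
Qed.

Lemma wright_wright n (w : n.+2.-tuple 'I_d) :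
  wright (addn1 n.+1) w = wright (addn1 1) (wright (addn2 n) w).
Proof.
apply: eq_from_tnth => i; rewrite !tnth_mktuple; congr tnth; apply: val_inj => /=.
by rewrite addnA addn1.
Qed.

Lemma word_weight_ge0 (mu : 'rV[R]_d) n (w : n.-tuple 'I_d) :
  (forall i, 0 < mu 0 i) -> 0 <= word_weight mu w.
Proof. by move=> mu0; apply: sumr_ge0 => i _; exact: ltW. Qed.

Lemma word_weight_gt0 (mu : 'rV[R]_d) n (w : n.+1.-tuple 'I_d) :
  (forall i, 0 < mu 0 i) -> 0 < word_weight mu w.
Proof.
move=> mu0; rewrite /word_weight big_tuple big_ord_recl ltr_pwDl//.
by apply: sumr_ge0 => i _; exact: ltW.
Qed.

Lemma word_weightB (mu nu : 'rV[R]_d) (w : seq 'I_d) :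
  word_weight (mu - nu) w = word_weight mu w - word_weight nu w.
Proof. by rewrite /word_weight -sumrB; apply: eq_bigr => i _; rewrite !mxE. Qed.

Lemma normr_le_tnorm n (A : tensor R d n) w : `|A w| <= tnorm A.
Proof.
rewrite -sqrtr_sqr /tnorm ler_wsqrtr// (bigD1 w)//= lerDl.
by apply: sumr_ge0 => i _; exact: sqr_ge0.
Qed.

Lemma tnorm_le_sum n (A : tensor R d n) : tnorm A <= \sum_w `|A w|.
Proof.
have S0 (P : pred (n.-tuple 'I_d)) : 0 <= \sum_(w | P w) `|A w| by exact: sumr_ge0.
rewrite /tnorm -[leRHS]ger0_norm// -sqrtr_sqr ler_wsqrtr//.
rewrite expr2 mulr_suml; apply: ler_sum => w _.
by rewrite -real_normK ?num_real// expr2 ler_wpM2l// (bigD1 w)//= lerDl.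
Qed.

(** All limits of tensors can therefore be taken coefficient by coefficient. *)
Lemma tnorm_cvg0 (I : Type) (F : set_system I) (FF : Filter F) n (f : I -> tensor R d n) :
  (tnorm (f x) @[x --> F] --> (0 : R)) <-> (forall w, f x w @[x --> F] --> (0 : R)).
Proof.
split=> [h w|h].
  apply: norm_cvg0; apply: (squeeze_cvgr _ (cvg_cst 0) h).
  by apply: nearW => x; rewrite normr_ge0 normr_le_tnorm.
have hs : \sum_w `|f x w| @[x --> F] --> \sum_(w : n.-tuple 'I_d) `|0 : R|.
  apply: cvg_big => [|w _]; first exact: add_continuous.
  exact: cvg_norm.
rewrite big1 in hs; last by move=> *; rewrite normr0.
apply: (squeeze_cvgr _ (cvg_cst 0) hs).
by apply: nearW => x; rewrite sqrtr_ge0 tnorm_le_sum.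
Qed.

End Words.

(** * Rough convolutions as sewn germs *)

Section Rescaled.
Context {R : realType} {d : nat} (lambda : 'rV[R]_d) (X : rough_pair R d).
Local Notation wt w := (word_weight lambda w).

(** Multiplying the operator [D_(t-u)] by [e^(lambda^w t)] leaves [e^(lambda^w u)]:
    the germ does not see the final time [t]. *)
Definition rescaled_germ n (Y : R -> tensor R d n) (Y' : R -> tensor R d n.-1)
    (w : n.+1.-tuple 'I_d) u v : R :=
  expR (wt w * u) * rough_increment X u v (Y u) (Y' u) w.

Lemma rough_sum_rescaled n (Y : R -> tensor R d n) (Y' : R -> tensor R d n.-1) r t P w :
  rough_sum lambda X Y Y' r t P w =
  expR (- (wt w * t)) * riemann_sum (rescaled_germ Y Y' w) r P.
Proof.
rewrite riemann_sumE /rough_sum sum_ffunE mulr_sumr; apply: eq_bigr => k _.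
rewrite ffunE /rescaled_germ mulrA -expRD; congr (expR _ * _); ring.
Qed.

Lemma is_convP n (Y : R -> tensor R d n) (Y' : R -> tensor R d n.-1) r t L :
  r <= t ->
  is_conv lambda X Y Y' r t L <->
  forall w : n.+1.-tuple 'I_d, is_sewn (rescaled_germ Y Y' w) r t (expR (wt w * t) * L w).
Proof.
move=> rt; have FF := mesh_to0_proper rt.
rewrite /is_conv tnorm_cvg0; split=> h w.
- have {h} h := h w.
  have : expR (wt w * t) * ((rough_sum lambda X Y Y' r t P - L) w + L w) @[P --> mesh_to0 r t]
    --> expR (wt w * t) * (0 + L w).
    by apply: cvgM; [exact: cvg_cst|apply: cvgD => //; exact: cvg_cst].
  rewrite add0r /is_sewn; apply: cvg_trans; apply: near_eq_cvg.
  apply: nearW => P; rewrite !ffunE rough_sum_rescaled addrNK mulrA -expRD subrr expR0.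
  by rewrite mul1r.
- have : expR (- (wt w * t)) * riemann_sum (rescaled_germ Y Y' w) r P - L w
     @[P --> mesh_to0 r t] --> expR (- (wt w * t)) * (expR (wt w * t) * L w) - L w.
    by apply: cvgB; [apply: cvgM; [exact: cvg_cst|exact: h]|exact: cvg_cst].
  rewrite mulrA -expRD addNr expR0 mul1r subrr; apply: cvg_trans; apply: near_eq_cvg.
  by apply: nearW => P; rewrite !ffunE rough_sum_rescaled.
Qed.

Lemma conv_finE n (Y : R -> tensor R d n) (Y' : R -> tensor R d n.-1) r t : r <= t ->
  (forall w, is_sewn (rescaled_germ Y Y' w) r t (sewn (rescaled_germ Y Y' w) r t)) ->
  is_conv lambda X Y Y' r t (conv_fin lambda X Y Y' r t) /\
  forall w : n.+1.-tuple 'I_d,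
    expR (wt w * t) * conv_fin lambda X Y Y' r t w = sewn (rescaled_germ Y Y' w) r t.
Proof.
move=> rt sw.
have ex : exists L, is_conv lambda X Y Y' r t L.
  exists [ffun w : n.+1.-tuple 'I_d => expR (- (wt w * t)) * sewn (rescaled_germ Y Y' w) r t].
  apply/is_convP => // w; rewrite ffunE mulrA -expRD subrr expR0 mul1r; exact: sw.
have h : is_conv lambda X Y Y' r t (conv_fin lambda X Y Y' r t).
  case: ex => L hL; exact: (xgetPex 0 (ex_intro _ L hL)).
split => // w; move/is_convP : h => /(_ rt w) h.
exact: is_sewn_uniq rt h (sw w).
Qed.

Lemma conv_ninftyE n (Y : R -> tensor R d n) (Y' : R -> tensor R d n.-1) t :
  (forall w r, r <= t -> is_sewn (rescaled_germ Y Y' w) r t (sewn (rescaled_germ Y Y' w) r t)) ->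
  (forall w, exists L, sewn (rescaled_germ Y Y' w) r t @[r --> -oo_R] --> (L : R)) ->
  is_conv_ninfty lambda X Y Y' t (Defs.conv lambda X Y Y' -oo%E t) /\
  forall w : n.+1.-tuple 'I_d, sewn (rescaled_germ Y Y' w) r t @[r --> -oo_R] -->
     expR (wt w * t) * Defs.conv lambda X Y Y' -oo%E t w.
Proof.
move=> sw /choice[l hl].
have ev : \forall r \near -oo_R, forall w : n.+1.-tuple 'I_d,
    conv_fin lambda X Y Y' r t w = expR (- (wt w * t)) * sewn (rescaled_germ Y Y' w) r t.
  exists t; split; first exact: num_real.
  move=> r rt w; have [_ <-] := conv_finE (ltW rt) (fun w => sw w r (ltW rt)).
  by rewrite mulrA -expRD addNr expR0 mul1r.
have ex : exists L, is_conv_ninfty lambda X Y Y' t L.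
  exists [ffun w : n.+1.-tuple 'I_d => expR (- (wt w * t)) * l w].
  rewrite /is_conv_ninfty tnorm_cvg0 => w.
  have : expR (- (wt w * t)) * sewn (rescaled_germ Y Y' w) r t - expR (- (wt w * t)) * l w
     @[r --> -oo_R] --> expR (- (wt w * t)) * l w - expR (- (wt w * t)) * l w.
    by apply: cvgB; [apply: cvgM; [exact: cvg_cst|exact: hl]|exact: cvg_cst].
  rewrite subrr; apply: cvg_trans; apply: near_eq_cvg.
  by apply: filterS ev => r E; rewrite !ffunE E.
have h : is_conv_ninfty lambda X Y Y' t (Defs.conv lambda X Y Y' -oo%E t).
  case: ex => L hL; exact: (xgetPex 0 (ex_intro _ L hL)).
split => // w; move: (h); rewrite /is_conv_ninfty tnorm_cvg0 => /(_ w) hw.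
have : expR (wt w * t) * ((conv_fin lambda X Y Y' r t - Defs.conv lambda X Y Y' -oo%E t) w
     + Defs.conv lambda X Y Y' -oo%E t w) @[r --> -oo_R]
    --> expR (wt w * t) * (0 + Defs.conv lambda X Y Y' -oo%E t w).
  by apply: cvgM; [exact: cvg_cst|apply: cvgD => //; exact: cvg_cst].
rewrite add0r; apply: cvg_trans; apply: near_eq_cvg.
apply: filterS ev => r E; rewrite !ffunE E addrNK mulrA -expRD subrr expR0 mul1r//.
Qed.

End Rescaled.

(** For a finite start [F t] is the sewn germ from [s] to [t]; for [s = -oo] it
    is the limit of the sewn germ from [r] to [t] as [r] tends to [-oo].  In both
    cases it is a primitive of the germ with the growth of the germ. *)
Lemma conv_primitive (R : realType) (d : nat) (lambda : 'rV[R]_d) (X : rough_pair R d)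
    (s : \bar R) (T : R) n (Y : R -> tensor R d n) (Y' : R -> tensor R d n.-1)
    (c : n.+1.-tuple 'I_d -> R) :
  (s <= T%:E)%E -> (forall w, 0 < c w) ->
  (forall w r t, (s <= r%:E)%E -> r <= t -> t <= T ->
     is_sewn (rescaled_germ lambda X Y Y' w) r t (sewn (rescaled_germ lambda X Y Y' w) r t)) ->
  (forall w u m v, (s <= u%:E)%E -> u <= m -> m <= v -> v <= T ->
     sewn (rescaled_germ lambda X Y Y' w) u v =
     sewn (rescaled_germ lambda X Y Y' w) u m + sewn (rescaled_germ lambda X Y Y' w) m v) ->
  (forall w, exists2 D, 0 <= D & forall u v, (s <= u%:E)%E -> u <= v -> v <= T ->
     `|sewn (rescaled_germ lambda X Y Y' w) u v| <= D * expR (c w * v)) ->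
  (forall t, (s <= t%:E)%E -> t <= T -> conv_exists lambda X Y Y' s t) /\
  forall w : n.+1.-tuple 'I_d,
    let F t := expR (word_weight lambda w * t) * Defs.conv lambda X Y Y' s t w in
    (forall u v, (s <= u%:E)%E -> u <= v -> v <= T ->
       F v - F u = sewn (rescaled_germ lambda X Y Y' w) u v) /\
    exists2 D, 0 <= D & forall t, (s <= t%:E)%E -> t <= T -> `|F t| <= D * expR (c w * t).
Proof.
case: s => [s| |] sT c0 sw addI grow; last first.
- have lim w t : t <= T -> exists L,
      sewn (rescaled_germ lambda X Y Y' w) r t @[r --> -oo_R] --> (L : R).
    move=> tT; have [D D0 hD] := grow w.
    apply: (cvg_ninfty_additive (c0 w) D0 _ _ tT).
      by move=> u m v; apply: addI; exact: leNye.
    by move=> u v; apply: hD; exact: leNye.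
  have cv t (tT : t <= T) := conv_ninftyE (fun w r rt => sw w r t (leNye _) rt tT)
    (fun w => lim w t tT).
  split=> [t _ tT|w F].
    split; last by exists (Defs.conv lambda X Y Y' -oo%E t); exact: (cv t tT).1.
    move=> r rt; exists (conv_fin lambda X Y Y' r t).
    by apply: (conv_finE rt (fun w => sw w r t (leNye _) rt tT)).1.
  have Fl t (tT : t <= T) : sewn (rescaled_germ lambda X Y Y' w) r t @[r --> -oo_R] --> F t.
    exact: (cv t tT).2.
  split=> [u v _ uv vT|].
    have uT := le_trans uv vT.
    have h : sewn (rescaled_germ lambda X Y Y' w) r v
        - sewn (rescaled_germ lambda X Y Y' w) r u @[r --> -oo_R] --> F v - F u.
      by apply: cvgB; exact: Fl.
    have h' : sewn (rescaled_germ lambda X Y Y' w) r v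
        - sewn (rescaled_germ lambda X Y Y' w) r u @[r --> -oo_R]
        --> sewn (rescaled_germ lambda X Y Y' w) u v.
      have : sewn (rescaled_germ lambda X Y Y' w) u v @[r --> -oo_R] -->
          sewn (rescaled_germ lambda X Y Y' w) u v by exact: cvg_cst.
      apply: cvg_trans; apply: near_eq_cvg; exists u; split; first exact: num_real.
      by move=> r /ltW ru; rewrite (addI w r u v)//; [ring|exact: leNye].
    exact: cvg_unique _ h h'.
  have [D D0 hD] := grow w; exists D => // t _ tT.
  apply: (cvgr_to_le (cvg_norm (Fl t tT))); exists t; split; first exact: num_real.
  by move=> r /ltW rt; apply: hD => //; exact: leNye.
- by rewrite leye_eq in sT.
have cv t (st : s <= t) (tT : t <= T) := conv_finE st (fun w => sw w s t (lexx _) st tT).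
split=> [t st tT|w F].
  exists (conv_fin lambda X Y Y' s t); exact: (cv t _ tT).1.
have FE t : s <= t -> t <= T -> F t = sewn (rescaled_germ lambda X Y Y' w) s t.
  by move=> st tT; exact: (cv t st tT).2.
split=> [u v|]; rewrite ?lee_fin.
  move=> su uv vT; have uT := le_trans uv vT; have sv := le_trans su uv.
  by rewrite !FE// (addI w s u v)//; ring.
have [D D0 hD] := grow w; exists D => // t; rewrite lee_fin => st tT.
by rewrite FE// hD.
Qed.

(** * Weighted norms and bounds on coefficients *)

Section Norms.
Context {R : realType} {d : nat} (lambda rho : 'rV[R]_d) (T : R).
Local Notation wt w := (word_weight lambda w).
Local Notation wk w := (word_weight (lambda - rho) w).

(** The weight [e^(rho (T - u))] allowed by the norm, multiplied by
    [e^(lambda u)], leaves [e^((lambda - rho) u)] up to a constant. *)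
Lemma holder_norm_bounded s (alpha : R) n (A : R -> R -> tensor R d n) (w : n.-tuple 'I_d) :
  alpha != 0 -> (holder_norm alpha rho -oo T A < +oo)%E ->
  (forall u, u <= T -> A u u = 0) ->
  bounded2 s T (wk w) alpha (fun u v => expR (wt w * u) * A u v w).
Proof.
move=> a0 hA A0.
pose S := ([set 0%E] `|` [set x | exists u v : R, [/\ (-oo < u%:E)%E, u < v, v <= T, v - u < 1 &
   x = (tnorm (Dop rho (T - u) (A u v)) / `|v - u| `^ alpha)%:E]] : set (\bar R)).
have Sle : forall x, S x -> (x <= holder_norm alpha rho -oo T A)%E.
  by move=> x Sx; apply: ereal_sup_ubound.
have : exists2 C : R, 0 <= C & (holder_norm alpha rho -oo T A <= C%:E)%E.
  have : (0 <= holder_norm alpha rho -oo T A)%E by apply: Sle; left.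
  move: hA; case: (holder_norm _ _ _ _ _) => [C| |]//= _; rewrite lee_fin => C0.
  by exists C.
case=> C C0 hC; exists (C * expR (word_weight rho w * T)).
  by rewrite mulr_ge0 ?expR_ge0.
move=> u m v _ um mv vT uv1; have := le_trans um mv.
rewrite le_eqVlt => /predU1P[<-|uv].
  rewrite A0; last exact: le_trans um (le_trans mv vT).
  by rewrite ffunE mulr0 normr0 !mulr_ge0 ?expR_ge0 ?powR_ge0.
have vu0 : 0 < v - u by rewrite subr_gt0.
have : ((tnorm (Dop rho (T - u) (A u v)) / `|v - u| `^ alpha)%:E <= C%:E)%E.
  apply: le_trans hC; apply: Sle; right; exists u, v; split => //; exact: ltNyr.
rewrite lee_fin ger0_norm ?(ltW vu0)// ler_pdivrMr ?powR_gt0// => h.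
have := le_trans (normr_le_tnorm _ w) h.
rewrite ffunE normrM ger0_norm ?expR_ge0// => {}h.
rewrite normrM ger0_norm ?expR_ge0//.
have -> : expR (wt w * u) = expR (word_weight rho w * T) * expR (wk w * u)
    * expR (- (word_weight rho w * (T - u))).
  by rewrite -!expRD word_weightB; congr expR; ring.
rewrite -[leLHS]mulrA.
rewrite [C * _]mulrC [leRHS]mulrACA.
by rewrite ler_wpM2l// mulr_ge0 ?expR_ge0.
Qed.

(** [hat_delta f] is, up to the factor [e^(- lambda^w v)], the ordinary increment
    of the rescaled function.  That factor is at most [e^(- lambda^w u)], since
    [lambda > 0], and the product of the latter with the weights
    [e^((lambda - rho)^w u)] and [e^(- rho^w (T - u))] is constant. *)
Lemma hatCb_bounded s (alpha : R) n (f : R -> tensor R d n) :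
  (forall i, 0 < lambda 0 i) -> 0 < alpha ->
  (forall w : n.-tuple 'I_d, weighted_holder s T alpha (wk w) (fun t => expR (wt w * t) * f t w)) ->
  hatCb lambda alpha rho s T f.
Proof.
move=> l0 a0 hf.
have ereal_sup_bnd (S : set (\bar R)) (C : R) : 0 <= C -> (forall x, S x -> (x <= C%:E)%E) ->
    (ereal_sup ([set 0%E] `|` S) < +oo)%E.
  move=> C0 SC; apply: (@le_lt_trans _ _ C%:E); last exact: ltry.
  by apply: ge_ereal_sup => x [->|/SC//]; rewrite lee_fin.
have tn_bnd (A : tensor R d n) (B : n.-tuple 'I_d -> R) q :
    (forall w, `|A w| <= B w * q) -> tnorm A <= (\sum_w B w) * q.
  move=> h; apply: (le_trans (tnorm_le_sum _)); rewrite mulr_suml.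
  by apply: ler_sum.
rewrite /hatCb /=; apply: lte_add_pinfty.
- have /choice[C hC] : forall w : n.-tuple 'I_d, exists C : R, 0 <= C /\
      forall u v, (s <= u%:E)%E -> u <= v -> v <= T -> v - u < 1 ->
      `|Dop rho (T - u) (hat_delta lambda f u v) w| <= C * (v - u) `^ alpha.
    move=> w; have [_ [C C0 hC]] := hf w.
    exists (C * expR (- (word_weight rho w * T))); split; first by rewrite mulr_ge0 ?expR_ge0.
    move=> u v su uv vT uv1; have := hC u u v su (lexx _) uv vT uv1.
    rewrite !ffunE normrM ger0_norm ?expR_ge0// => h.
    have -> : f v w + - (expR (- (wt w * (v - u))) * f u w) =
       expR (- (wt w * v)) * (expR (wt w * v) * f v w - expR (wt w * u) * f u w).
      rewrite [RHS]mulrBr !mulrA -!expRD addNr expR0 mul1r; congr (_ - expR _ * _); ring.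
    rewrite normrM ger0_norm ?expR_ge0// mulrA -expRD.
    apply: (le_trans (ler_wpM2l (expR_ge0 _) h)).
    rewrite -[leRHS]mulrA mulrCA ler_wpM2l// mulrA -expRD ler_wpM2r ?powR_ge0// ler_expR.
    rewrite word_weightB; have : 0 <= wt w * (v - u).
      by rewrite mulr_ge0 ?subr_ge0// word_weight_ge0.
    lra.
  apply: (ereal_sup_bnd _ (\sum_w C w)); first by apply: sumr_ge0 => w _; case: (hC w).
  move=> _ [u [v [su uv vT uv1 ->]]]; rewrite lee_fin.
  have vu0 : 0 < v - u by rewrite subr_gt0.
  rewrite ger0_norm ?(ltW vu0)// ler_pdivrMr ?powR_gt0//; apply: tn_bnd => w.
  by have [_ ->] := hC w => //; exact: ltW.
- have /choice[C hC] : forall w : n.-tuple 'I_d, exists C : R, 0 <= C /\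
      forall t, (s <= t%:E)%E -> t <= T -> `|Dop rho (T - t) (f t) w| <= C * 1.
    move=> w; have [[C C0 hC] _] := hf w.
    exists (C * expR (- (word_weight rho w * T))); split; first by rewrite mulr_ge0 ?expR_ge0.
    move=> t st tT; have := hC t t t st (lexx _) (lexx _) tT.
    rewrite subrr => /(_ ltr01); rewrite powRr0 mulr1 !ffunE !normrM.
    rewrite !(ger0_norm (expR_ge0 _)) => h.
    have -> : expR (- (word_weight rho w * (T - t))) =
        expR (- (word_weight rho w * T)) * expR (- (wk w * t)) * expR (wt w * t).
      by rewrite -!expRD word_weightB; congr expR; ring.
    have PK0 : 0 <= expR (- (word_weight rho w * T)) * expR (- (wk w * t)).
      by rewrite mulr_ge0 ?expR_ge0.
    rewrite -[leLHS]mulrA; apply: (le_trans (ler_wpM2l PK0 h)).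
    rewrite mulr1 mulrACA -mulrA -expRD addNr expR0 mulr1 mulrC.
    exact: lexx.
  apply: (ereal_sup_bnd _ (\sum_w C w)); first by apply: sumr_ge0 => w _; case: (hC w).
  move=> _ [t [st tT ->]]; rewrite lee_fin -[leRHS]mulr1; apply: tn_bnd => w.
  by have [_ ->] := hC w => //; exact: ltW.
Qed.

End Norms.

(** * The signature *)

Section Signature.
Context {R : realType} {d : nat} (lambda rho : 'rV[R]_d) (T alpha : R)
  (X : rough_pair R d) (s : \bar R).
Hypothesis halpha : 3^-1 < alpha <= 2^-1.
Hypothesis hrho : forall i, 0 < rho 0 i < lambda 0 i.
Hypothesis hX : weighted_rough_path alpha rho T X.
Hypothesis hs : (s <= T%:E)%E.
Local Notation wt w := (word_weight lambda w).
Local Notation wk w := (word_weight (lambda - rho) w).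

Definition rescaled_level1 (i : 1.-tuple 'I_d) u v : R := expR (wt i * u) * X.1 u v i.
Definition rescaled_level2 (w : 2.-tuple 'I_d) u v : R := expR (wt w * u) * X.2 u v w.
Definition rescaled_efm n (w : n.-tuple 'I_d) t : R :=
  expR (wt w * t) * efm lambda X s n t w.
Definition efm_germ n (w : n.+1.-tuple 'I_d) : R -> R -> R :=
  rescaled_germ lambda X (efm lambda X s n) (efm_pred lambda X s n) w.
Definition leading_term n (w : n.+1.-tuple 'I_d) u v : R :=
  rescaled_efm (wleft (addn1 n) w) u * rescaled_level1 (wright (addn1 n) w) u v.

Lemma lambda_gt0 i : 0 < lambda 0 i.
Proof. by have /andP[h1 h2] := hrho i; exact: lt_trans h2. Qed.

Lemma lambda_rho_gt0 i : 0 < (lambda - rho) 0 i.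
Proof. by have /andP[h1 h2] := hrho i; rewrite !mxE subr_gt0. Qed.

Lemma alpha_gt0 : 0 < alpha.
Proof. by have /andP[h1 h2] := halpha; lra. Qed.

Lemma decay_expR (l u m x : R) : decay l u m * (expR (l * m) * x) = expR (l * u) * x.
Proof. by rewrite mulrA -expRD; congr (expR _ * _); ring. Qed.

Lemma rescaled_level1_split (i : 1.-tuple 'I_d) u m v : u <= m -> m <= v -> v <= T ->
  rescaled_level1 i u v =
  rescaled_level1 i u m + decay (wt i) u m * rescaled_level1 i m v.
Proof.
move=> um mv vT; have [[x hx] _ _ _] := hX.
rewrite decay_expR /rescaled_level1 !hx ?(le_trans um)// ?(le_trans mv)//.
rewrite !ffunE; ring.
Qed.

(** Chen's identity; each decay factor turns the weight at the time [m] of an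
    increment over [[m, v]] into the weight at the time [u], which the left-hand
    side carries. *)
Lemma rescaled_level2_split (w : 2.-tuple 'I_d) u m v : u <= m -> m <= v -> v <= T ->
  rescaled_level2 w u v = rescaled_level2 w u m
    + decay (wt (wleft (addn1 1) w) + wt (wright (addn1 1) w)) u m * rescaled_level2 w m v
    + rescaled_level1 (wleft (addn1 1) w) u m *
      (decay (wt (wright (addn1 1) w)) u m * rescaled_level1 (wright (addn1 1) w) m v).
Proof.
move=> um mv vT; have [_ _ _ hch] := hX.
rewrite -word_weight_split !decay_expR /rescaled_level2 (hch _ m)//.
rewrite !ffunE -/(wleft (addn1 1) w) -/(wright (addn1 1) w) /rescaled_level1.
rewrite (word_weight_split lambda (addn1 1) w) mulrDl expRD; ring.
Qed.

Lemma rescaled_level1_bounded (i : 1.-tuple 'I_d) : bounded2 s T (wk i) alpha (rescaled_level1 i).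
Proof.
have [[x hx] h1 _ _] := hX.
apply: holder_norm_bounded h1 _; first exact/lt0r_neq0/alpha_gt0.
by move=> u uT; rewrite hx// subrr.
Qed.

Lemma rescaled_level2_bounded (w : 2.-tuple 'I_d) :
  bounded2 s T (wk w) (2 * alpha) (rescaled_level2 w).
Proof.
have [[x hx] _ h2 hch] := hX.
apply: holder_norm_bounded h2 _; first by rewrite lt0r_neq0// mulr_gt0 ?alpha_gt0.
move=> u uT; have := hch u u u (lexx _) (lexx _) uT.
have -> : tprod (addn1 1) (X.1 u u) (X.1 u u) = 0.
  by apply/ffunP => w'; rewrite tprodE hx// subrr !ffunE mul0r.
by rewrite addr0 => /eqP; rewrite -subr_eq0 opprD addrA subrr sub0r oppr_eq0 => /eqP.
Qed.

(** The lowest level is a degenerate case of the general germ, without second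
    order part. *)
Lemma efm_germ0 w : efm_germ (n := 0) w =
  rough_germ (rescaled_efm (wleft (addn1 0) w)) (fun=> 0)
    (rescaled_level1 (wright (addn1 0) w)) (fun _ _ => 0).
Proof.
apply/funext => u; apply/funext => v.
rewrite /efm_germ /rescaled_germ /rough_germ /= tprodE mul0r addr0.
rewrite /rescaled_efm /rescaled_level1 (word_weight_split lambda (addn1 0)) mulrDl expRD.
by rewrite mulrACA.
Qed.

Lemma efm_germS n (w : n.+2.-tuple 'I_d) : efm_germ w =
  rough_germ (rescaled_efm (wleft (addn1 n.+1) w)) (rescaled_efm (wleft (addn2 n) w))
    (rescaled_level1 (wright (addn1 n.+1) w)) (rescaled_level2 (wright (addn2 n) w)).
Proof.
apply/funext => u; apply/funext => v.
rewrite /efm_germ /rescaled_germ /rough_germ [rough_increment _ _ _ _ _ _]ffunE !tprodE.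
rewrite mulrDr /rescaled_efm /rescaled_level1 /rescaled_level2.
congr (_ + _).
  by rewrite (word_weight_split lambda (addn1 n.+1)) mulrDl expRD mulrACA.
by rewrite (word_weight_split lambda (addn2 n)) mulrDl expRD mulrACA.
Qed.

(** The induction hypothesis: [rescaled_efm w] is bounded and Hoelder with the
    weight [lambda - rho], and is controlled by the rough path, its derivative
    being the preceding level of the signature. *)
Definition controlled n : Prop :=
  (forall w : n.-tuple 'I_d, weighted_holder s T alpha (wk w) (rescaled_efm w)) /\
  match n return Prop with
  | 0 => True
  | m.+1 => forall w : m.+1.-tuple 'I_d, bounded2 s T (wk w) (2 * alpha)
      (fun u v => rescaled_efm w v - rescaled_efm w u - leading_term w u v)
  end.

(** What makes the next level of the signature well-defined and controlled. *)
Definition sewable n : Prop := forall w : n.+1.-tuple 'I_d, [/\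
  bounded3 s T (wk w) (3 * alpha) (defect (efm_germ w)),
  bounded2 s T (wk w) (2 * alpha) (fun u v => efm_germ w u v - leading_term w u v) &
  bounded2 s T (wk w) alpha (leading_term w)].

Lemma bounded2_cst0 c e : bounded2 s T c e (fun _ _ => 0).
Proof. by exists 0 => // *; rewrite normr0 mul0r. Qed.

Lemma controlled0 : controlled 0.
Proof.
split=> // w; have E t : rescaled_efm w t = 1.
  by rewrite /rescaled_efm ffunE tuple0 /word_weight big_nil mul0r expR0 mulr1.
split.
  exists 1 => // u m v *; rewrite E normr1 powRr0 tuple0 /word_weight big_nil mul0r expR0.
  by rewrite !mulr1.
by apply: bounded3_eq (bounded2_cst0 _ _) => *; rewrite !E subrr.
Qed.

Lemma leading_term_bounded n :
  (forall w : n.-tuple 'I_d, weighted_holder s T alpha (wk w) (rescaled_efm w)) ->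
  forall w : n.+1.-tuple 'I_d, bounded2 s T (wk w) alpha (leading_term w).
Proof.
move=> h w; have [h0 _] := h (wleft (addn1 n) w).
rewrite (word_weight_split _ (addn1 n)) -[alpha]add0r.
apply: bounded3M => //; first exact: ltW alpha_gt0.
exact: rescaled_level1_bounded.
Qed.

Lemma sewable0 : sewable 0.
Proof.
have [h0 _] := controlled0.
move=> w; split; last exact: leading_term_bounded.
  rewrite efm_germ0 (word_weight_split _ (addn1 0)).
  have -> : wk (wleft (addn1 0) w) = 0 + 0 :> R.
    by rewrite tuple0 /word_weight big_nil addr0.
  apply: (@rough_germ_defect_bounded _ _ _ _ halpha 0 0 _ 0
    (wt (wright (addn1 0) w)) _ _ _ (fun _ _ => 0)) => //.
  - by rewrite word_weight_ge0//; exact: lambda_rho_gt0.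
  - by rewrite word_weight_ge0//; exact: lambda_gt0.
  - exact: rescaled_level1_bounded.
  - exact: bounded2_cst0.
  - exact: bounded2_cst0.
  - exact: rescaled_level1_split.
  - by move=> *; ring.
  - split; first exact: bounded2_cst0.
    by apply: bounded3_eq (bounded2_cst0 _ _) => *; rewrite subrr.
  - have := h0 (wleft (addn1 0) w).
    by rewrite (tuple0 (wleft (addn1 0) w)) /word_weight big_nil addr0.
  - have E t : rescaled_efm (wleft (addn1 0) w) t = 1.
      by rewrite /rescaled_efm ffunE tuple0 /word_weight big_nil mul0r expR0 mulr1.
    by apply: bounded3_eq (bounded2_cst0 _ _) => *; rewrite !E; ring.
rewrite efm_germ0; apply: bounded3_eq (bounded2_cst0 _ _) => *.
by rewrite /rough_germ /leading_term mul0r addr0 subrr.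
Qed.

(** The word [w = w' j i] is split in two ways: [w' j] and [i] in front of
    the first level, [w'] and [j i] in front of the second one. *)
Lemma sewableS n : controlled n -> controlled n.+1 -> sewable n.+1.
Proof.
move=> [g0 _] [f0 f2] w; have a0 := alpha_gt0.
have Ec : wk w = wk (wleft (addn2 n) w) + wk (wleft (addn1 1) (wright (addn2 n) w))
    + wk (wright (addn1 n.+1) w) :> R.
  rewrite (word_weight_split _ (addn2 n)) (word_weight_split _ (addn1 1)) addrA.
  by rewrite -wright_wright.
have Ef : wk (wleft (addn1 n.+1) w) = wk (wleft (addn2 n) w)
    + wk (wleft (addn1 1) (wright (addn2 n) w)) :> R.
  by rewrite (word_weight_split _ (addn1 n)) wleft_wleft wright_wleft.
split; last exact: leading_term_bounded.
  rewrite efm_germS Ec.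
  apply: (@rough_germ_defect_bounded _ _ _ _ halpha _ _ _
    (wt (wleft (addn1 1) (wright (addn2 n) w))) (wt (wright (addn1 n.+1) w)) _ _ _
    (rescaled_level1 (wleft (addn1 1) (wright (addn2 n) w)))).
  - by rewrite word_weight_ge0//; exact: lambda_rho_gt0.
  - by rewrite word_weight_ge0//; exact: lambda_rho_gt0.
  - by rewrite word_weight_ge0//; exact: lambda_gt0.
  - by rewrite word_weight_ge0//; exact: lambda_gt0.
  - exact: rescaled_level1_bounded.
  - exact: rescaled_level1_bounded.
  - by rewrite wright_wright -word_weight_split; exact: rescaled_level2_bounded.
  - exact: rescaled_level1_split.
  - by rewrite wright_wright; exact: rescaled_level2_split.
  - exact: g0.
  - by rewrite -Ef; exact: f0.
  - have := f2 (wleft (addn1 n.+1) w); rewrite Ef.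
    by rewrite /leading_term wleft_wleft wright_wleft.
have := bounded3M (lexx _) (mulr_ge0 (ler0n _ 2) (ltW a0)) (g0 (wleft (addn2 n) w)).1
  (rescaled_level2_bounded (wright (addn2 n) w)).
rewrite add0r -word_weight_split; apply: bounded3_eq => u m v *.
by rewrite efm_germS /rough_germ /leading_term addrAC subrr add0r.
Qed.

Lemma conv_exists_controlledS n : sewable n ->
  (forall t, (s <= t%:E)%E -> t <= T ->
     conv_exists lambda X (efm lambda X s n) (efm_pred lambda X s n) s t) /\
  controlled n.+1.
Proof.
move=> hn; have /andP[a13 a12] := halpha.
have th1 : 1 < 3 * alpha by lra.
have k0 (w : n.+1.-tuple 'I_d) : 0 < wk w by apply: word_weight_gt0 => i; exact: lambda_rho_gt0.
have sw (w : n.+1.-tuple 'I_d) := sewn_bounded th1 (ltW (k0 w)) (let: And3 h _ _ := hn w in h).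
have add_ (w : n.+1.-tuple 'I_d) := sewn_additive th1 (ltW (k0 w)) (let: And3 h _ _ := hn w in h).
have grow (w : n.+1.-tuple 'I_d) :=
  let: And3 h1 h2 h3 := hn w in sewn_growth halpha (k0 w) h1 h2 h3.
have [cex hF] := conv_primitive hs k0 (fun w => (sw w).1) add_ grow.
have ctrl (w : n.+1.-tuple 'I_d) :
    weighted_holder s T alpha (wk w) (rescaled_efm w) /\ bounded2 s T (wk w) (2 * alpha)
      (fun u v => rescaled_efm w v - rescaled_efm w u - leading_term w u v).
  have [h1 h2 h3] := hn w; have [FI [D D0 hD]] := hF w.
  exact: (primitive_controlled (F := rescaled_efm w) halpha (k0 w) h1 h2 h3 FI D0 hD).
by split=> //; split=> w; have [] := ctrl w.
Qed.

Lemma sewable_controlled n : sewable n /\ controlled n.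
Proof.
suff h k : [/\ controlled k, controlled k.+1, sewable k & sewable k.+1].
  by have [h1 _ h2 _] := h n.
elim: k => [|k [c1 c2 s1 s2]].
  have c1 := (conv_exists_controlledS sewable0).2.
  by split; [exact: controlled0|exact: c1|exact: sewable0|exact: (sewableS controlled0)].
have c3 := (conv_exists_controlledS s2).2.
by split => //; exact: sewableS.
Qed.

End Signature.

Theorem theorem3p13 (R : realType) (d : nat) (hd : (1 <= d)%N) (T : R)
    (lambda : 'rV[R]_d) (hlambda : forall i, 0 < lambda 0 i)
    (alpha : R) (halpha : 3^-1 < alpha <= 2^-1)
    (rho : 'rV[R]_d) (hrho : forall i, 0 < rho 0 i < lambda 0 i)
    (X : rough_pair R d) (hX : weighted_rough_path alpha rho T X) :
  efm_well_defined lambda X T /\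
  forall (s : \bar R) (n : nat), (s <= T%:E)%E ->
    hatCb lambda alpha rho s T (efm lambda X s n).
Proof.
split=> [n s t st tT|s n sT].
  have sT : (s <= T%:E)%E by rewrite (le_trans st)// lee_fin.
  have [h _] := sewable_controlled halpha hrho hX sT n.
  exact: (conv_exists_controlledS halpha hrho sT h).1.
have [_ [h _]] := sewable_controlled halpha hrho hX sT n.
exact: (hatCb_bounded hlambda (alpha_gt0 halpha) h).
Qed.
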